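(* Let $K\subseteq\mathbb R^2$ be a compact set containing no array on three points, let $f\in C(K)$ and $\varepsilon>0$. Then there exist continuous functions $g,h\in C(\mathbb R)$ such that (1) $|f(x,y)-g(x)-h(y)|\le 6\varepsilon$ for all $(x,y)\in K$, and (2) $\|g\|\le\|f\|$ and $\|h\|\le 2\|f\|$.
   Context: An array on three points is a triple $a_1,a_2,a_3$ of points in the plane with $a_1\ne a_2$, $a_2\ne a_3$, such that the segments $[a_1;a_2]$ and $[a_2;a_3]$ are each parallel to a coordinate axis and are mutually orthogonal. $\|\cdot\|$ denotes the supremum norm (on $K$ for $f$, on $\mathbb R$ for $g,h$). *)

(* Defs.v *)
From HB Require Import structures.
From mathcomp Require Import all_boot all_order all_algebra.
From mathcomp Require Import all_classical all_reals all_analysis.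
Set Implicit Arguments. Unset Strict Implicit. Unset Printing Implicit Defensive.
Import Order.TTheory GRing.Theory Num.Theory.
Import numFieldNormedType.Exports.
Local Open Scope classical_set_scope.
Local Open Scope ring_scope.

(* An array on three points: a1 <> a2, a2 <> a3, and the segments [a1;a2],
   [a2;a3] are axis-parallel and mutually orthogonal, i.e. one is vertical
   (equal first coordinates) and the other horizontal (equal second coords). *)
Definition is_array3 (R : realType) (a1 a2 a3 : R * R) : Prop :=
  a1 <> a2 /\ a2 <> a3 /\
  ((a1.1 = a2.1 /\ a2.2 = a3.2) \/ (a1.2 = a2.2 /\ a2.1 = a3.1)).

Definition no_array3 (R : realType) (K : set (R * R)) : Prop :=
  ~ (exists a1 a2 a3, K a1 /\ K a2 /\ K a3 /\ is_array3 a1 a2 a3).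

(* Supremum norm of f on K (f continuous on compact K, so bounded). *)
Definition supnorm (R : realType) (K : set (R * R)) (f : R * R -> R) : R :=
  sup [set `|f p| | p in K].

(* Main.v *)
Require Import Defs.
From HB Require Import structures.
From mathcomp Require Import all_boot all_order all_algebra.
From mathcomp Require Import all_classical all_reals all_analysis.
From mathcomp Require Import lra.
Import Order.TTheory GRing.Theory Num.Theory.
Import numFieldNormedType.Exports.
Local Open Scope classical_set_scope.
Local Open Scope ring_scope.

(* It suffices to find a continuous [g], bounded by [||f||], such that
   [F := f - g(x)] oscillates little on every row of [K]: then [F] is close to
   a continuous function of [y], and [||F|| <= 2 ||f||].  A point of [K] with a
   mate in its row is alone in its column, so on the rows of diameter at least
   a small [d] the function [f] depends on [x] only; extend it to some [g0]
   defined on the line.  The rows on which [f - g0] oscillates much form a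
   closed set away from those wide rows.  Hence [g := chi * g0], with a cutoff
   [chi] that is 1 on the wide rows, 0 on the bad ones and almost constant on
   each row, does the job: on a narrow row, [f] itself oscillates little.
   The cutoff exists because "lying in a common row" is a closed equivalence
   relation on the projection of [K], again by the absence of arrays. *)

(** * Continuity, closedness and compactness *)

Section continuity.
Context {R : realType} {T : topologicalType}.
Implicit Types u v : T -> R.

Lemma continuous_fun_comp {U V : topologicalType} (f : U -> V) (g : T -> U) :
  continuous f -> continuous g -> continuous (fun x => f (g x)).
Proof. by move=> cf cg x; apply: (@continuous_comp _ _ _ g f); [exact: cg|exact: cf]. Qed.

Lemma continuous_funB u v :
  continuous u -> continuous v -> continuous (fun x => u x - v x).
Proof. by move=> cu cv x; exact: cvgB (cu x) (cv x). Qed.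

Lemma continuous_dist u v :
  continuous u -> continuous v -> continuous (fun x => `|u x - v x|).
Proof.
move=> cu cv; apply: continuous_fun_comp; first exact: norm_continuous.
exact: continuous_funB.
Qed.

Lemma closed_superlevel u (a : R) : continuous u -> closed [set x | a <= u x].
Proof. by move=> cu; apply: closed_comp (@closed_ge _ a) => x _; exact: cu. Qed.

Lemma closed_equalizer u v :
  continuous u -> continuous v -> closed [set x | u x = v x].
Proof.
move=> cu cv.
have -> : [set x | u x = v x] = (fun x => u x - v x) @^-1` [set x | x = 0].
  by apply/seteqP; split => x /= /eqP h; apply/eqP; rewrite ?subr_eq0 // -subr_eq0.
by apply: closed_comp (@closed_eq _ 0) => x _; exact: continuous_funB.
Qed.

Lemma compact_pos_lb (S : set T) u :
  compact S -> continuous u -> (forall s, S s -> 0 < u s) ->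
  exists2 d, 0 < d & forall s, S s -> d <= u s.
Proof.
move=> cS cu u_gt0; have [S0|S0] := pselect (S !=set0); last first.
  by exists 1 => // s Ss; case: S0; exists s.
have [c /set_mem cS' cmin] := compact_EVT_min S0 cS (continuous_subspaceT cu).
exists (u c) => [|s Ss]; first exact: u_gt0.
exact/cmin/mem_set.
Qed.

End continuity.

Lemma fst_continuous {U V : topologicalType} : continuous (@fst U V).
Proof. by move=> x; exact: cvg_fst. Qed.

Lemma snd_continuous {U V : topologicalType} : continuous (@snd U V).
Proof. by move=> x; exact: cvg_snd. Qed.

Lemma compact_image_continuous {U V : topologicalType} (f : U -> V) (A : set U) :
  continuous f -> compact A -> compact (f @` A).
Proof. by move=> /continuous_subspaceT cf; exact: continuous_compact. Qed.

(** * Approximate factorization through a continuous map *)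

Lemma lipschitz_continuous {R : realType} (h : R -> R) (L : R) :
  0 <= L -> (forall s t, h s <= h t + L * `|s - t|) -> continuous h.
Proof.
move=> L0 hL x; apply/cvgrPdist_le => e e0.
near=> y.
have xy : `|x - y| <= e / (L + 1).
  near: y; apply: cvgr_dist_le; first exact: cvg_id.
  by apply: divr_gt0 => //; lra.
have Lxy : L * `|x - y| <= e.
  rewrite (le_trans (ler_wpM2l L0 xy))// mulrA ler_pdivrMr; last lra.
  by rewrite mulrC ler_pM2l//; lra.
have h1 := hL x y; have := hL y x; rewrite (distrC y x) => h2.
by rewrite ler_norml; apply/andP; split; lra.
Unshelve. all: by end_near. Qed.

(* The inf-convolution [inf_p (F p + L |t - pi p|)] is [L]-Lipschitz in [t];
   for [L] large only the [p] with [pi p] close to [t] contribute, and by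
   compactness [F] oscillates by at most [c + e] over those. *)
Lemma approx_factor {R : realType} {T : topologicalType} (S : set T)
    (pi F : T -> R) (M c e : R) :
  compact S -> continuous pi -> continuous F -> 0 <= M -> 0 < e ->
  (forall p, S p -> `|F p| <= M) ->
  (forall p q, S p -> S q -> pi p = pi q -> `|F p - F q| <= c) ->
  exists h : R -> R, [/\ continuous h, forall t, `|h t| <= M &
    forall p, S p -> `|F p - h (pi p)| <= c + e].
Proof.
move=> cS cpi cF M0 e0 FM Fc.
have [S0|S0] := pselect (S !=set0); last first.
  exists (fun=> 0); split=> [|t|p Sp]; [exact: cst_continuous|by rewrite normr0|].
  by case: S0; exists p.
have c0 : 0 <= c.
  by case: S0 => p Sp; have := Fc p p Sp Sp erefl; rewrite subrr normr0.
pose D := (S `*` S) `&` [set z | c + e <= `|F z.1 - F z.2|].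
have cD : compact D.
  apply: compact_closedI; first exact: compact_setX.
  apply/closed_superlevel/continuous_dist.
    exact: continuous_fun_comp fst_continuous.
  exact: continuous_fun_comp snd_continuous.
have [|z [[/= Sz1 Sz2] zD]|eta eta0 Deta] :=
    compact_pos_lb D (fun z => `|pi z.1 - pi z.2|) cD.
- apply: continuous_dist; first exact: continuous_fun_comp fst_continuous.
  exact: continuous_fun_comp snd_continuous.
- rewrite normr_gt0 subr_eq0; apply/eqP => /(Fc _ _ Sz1 Sz2).
  by lra.
(* Once [pi p] and [pi q] are [eta] apart, the penalty is at least [2 * M], which outweighs any
   difference of values of [F] on [S]. *)
pose L := 2 * M / eta.
have L0 : 0 <= L by apply: divr_ge0; lra.
pose G t := [set F p + L * `|t - pi p| | p in S].
have GM t : lbound (G t) (- M).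
  move=> _ [p Sp <-]; have := FM p Sp; rewrite ler_norml => /andP[+ _].
  have : 0 <= L * `|t - pi p| by apply: mulr_ge0.
  lra.
have Glb t : has_lbound (G t) by exists (- M).
have G0 t : G t !=set0 by case: S0 => p Sp; exists (F p + L * `|t - pi p|), p.
pose h0 t := inf (G t).
have h0M t : - M <= h0 t by apply: lb_le_inf.
have h0le t p : S p -> h0 t <= F p + L * `|t - pi p|.
  by move=> Sp; apply: ge_inf => //; exists p.
have h0L s t : h0 s <= h0 t + L * `|s - t|.
  rewrite -lerBlDr; apply: lb_le_inf => // _ [p Sp <-].
  have := h0le s p Sp.
  have : L * `|s - pi p| <= L * (`|s - t| + `|t - pi p|).
    by rewrite ler_wpM2l// ler_distD.
  by rewrite mulrDr; lra.
have ch0 := lipschitz_continuous _ _ L0 h0L.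
exists (fun t => Num.min (h0 t) M); split.
- by move=> t; apply: continuous_min; [exact: ch0|exact: cst_continuous].
- move=> t; rewrite ler_norml ge_min lexx orbT andbT le_min h0M /=; lra.
move=> p Sp; have := FM p Sp; rewrite ler_norml => /andP[Fp1 Fp2].
have h0p : h0 (pi p) <= F p.
  by have := h0le (pi p) p Sp; rewrite subrr normr0 mulr0 addr0.
rewrite min_l; last lra.
have : F p - (c + e) <= h0 (pi p).
  apply: lb_le_inf => // _ [q Sq <-].
  have [close|far] := ltP (`|F p - F q|) (c + e).
    have : 0 <= L * `|pi p - pi q| by apply: mulr_ge0.
    by move: close; rewrite ltr_norml; lra.
  have /(Deta (p, q)) /= : D (p, q) by [].
  move=> /(ler_wpM2l L0); rewrite {1}/L divfK ?gt_eqF//.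
  by have := FM q Sq; rewrite ler_norml; lra.
by rewrite ler_norml; lra.
Qed.

(** * Almost invariant cutoff functions *)

(* [w / n] is a cutoff that is invariant under [T] up to [1 / n]: it sums [n]
   Urysohn functions, the next one being already 1 on the [T]-saturation of
   the support of the previous one, so that on each class at most one of the
   summands is not constant. *)
Lemma staircase {R : realType} (T : set (R * R)) (B : set R) :
  compact T -> (forall x y, T (x, y) -> T (y, x)) ->
  closed B -> (forall x y, T (x, y) -> B x -> B y) ->
  forall (n : nat) (A : set R), closed A -> A `&` B = set0 ->
  exists w : R -> R, [/\ continuous w, forall x, 0 <= w x <= n%:R,
    forall x, A x -> w x = n%:R, forall x, B x -> w x = 0 &
    forall x y, T (x, y) -> `|w x - w y| <= 1].
Proof.
move=> cT Tsym clB Bsat; elim=> [|n IHn] A clA AB0.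
  exists (fun=> 0); split => [|x|//|//|x y _].
  - exact: cst_continuous.
  - by rewrite lexx.
  - by rewrite subrr normr0.
(* The new summand is the positive part of [u]. Starting from -1 on [B] keeps its support inside the
   closed set [N], which misses [B]. *)
have [||u [cu uB uA u1]] := @urysohn_ext_itv _ R
    (@pseudometric_normal R R) B A (-1) 1 clB clA; [by rewrite setIC|lra|].
have {}uB x : B x -> u x = -1 by move=> Bx; apply: uB; exists x.
have {}uA x : A x -> u x = 1 by move=> Ax; apply: uA; exists x.
have {}u1 x : u x <= 1.
  have /u1 : range u (u x) by exists x.
  by rewrite /= in_itv/= => /andP[].
pose N := [set x | 0 <= u x].
(* [T] is not assumed reflexive, so [N] is added by hand to the set of points related to it. *)
pose C := N `|` (fst @` (T `&` [set z | 0 <= u z.2])).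
have clC : closed C.
  apply: closedU; first exact: closed_superlevel.
  apply: compact_closed; first exact: Rhausdorff.
  apply: compact_image_continuous; first exact: fst_continuous.
  apply: compact_closedI => //; apply: closed_superlevel.
  exact: continuous_fun_comp snd_continuous.
have CB0 : C `&` B = set0.
  apply/seteqP; split => // x [[Nx|[[a b] [/= Tab ub] <-]] Bx].
    by move: Nx; rewrite /N /= (uB x Bx); lra.
  by move: ub; rewrite (uB b (Bsat _ _ Tab Bx)); lra.
have [w [cw w0n wC wB wT]] := IHn C clC CB0.
pose v x := Num.max (u x) 0.
have v01 x : 0 <= v x <= 1 by rewrite le_max lexx orbT ge_max u1 ler01.
exists (fun x => w x + v x); split.
- move=> x; apply: cvgD; first exact: cw.
  by apply: continuous_max; [exact: cu|exact: cst_continuous].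
- by move=> x; rewrite -natr1; have := w0n x; have := v01 x; lra.
- move=> x Ax; rewrite /v (uA x Ax) wC; first by rewrite max_l ?ler01// natr1.
  by left; rewrite /N /= uA.
- by move=> x Bx; rewrite wB // /v (uB x Bx) max_r; lra.
(* Both points lie in [C], where [w] is the constant [n]; only [v], with values in [0, 1], can
   differ. *)
have key x y : T (x, y) -> 0 <= u x -> `|w x + v x - (w y + v y)| <= 1.
  move=> Txy ux; rewrite (wC x); last by left.
  rewrite (wC y); last by right; exists (y, x) => //; split => //; exact: Tsym.
  by have := v01 x; have := v01 y; rewrite ler_norml; lra.
move=> x y Txy; have [ux|ux] := leP 0 (u x); first exact: key.
have [uy|uy] := leP 0 (u y); first by rewrite distrC; apply: key => //; exact: Tsym.
by rewrite /v (max_r (ltW ux)) (max_r (ltW uy)) !addr0; exact: wT.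
Qed.

(** * Rows and columns of a compact set without arrays *)

Section rows.
Context {R : realType} (K : set (R * R)).

Definition row_pairs : set ((R * R) * (R * R)) :=
  (K `*` K) `&` [set z | z.1.2 = z.2.2].

Definition row_rel : set (R * R) := [set (z.1.1, z.2.1) | z in row_pairs].

(** This is pointwise: the middle points of a row with two points [d] apart may be missing;
    [wide_row] recovers them at [d / 2]. *)
Definition wide (d : R) : set R :=
  [set z.1.1 | z in row_pairs `&` [set z | d <= `|z.1.1 - z.2.1|]].

Definition row_saturation (Q : set ((R * R) * (R * R))) : set R :=
  [set z.1.1 | z in (K `*` (row_pairs `&` Q)) `&` [set z | z.1.2 = z.2.1.2]].

Let c1 : continuous (fun z : (R * R) * (R * R) => z.1.1).
Proof. by apply: continuous_fun_comp fst_continuous; exact: fst_continuous. Qed.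
Let c2 : continuous (fun z : (R * R) * (R * R) => z.2.1).
Proof. by apply: continuous_fun_comp snd_continuous; exact: fst_continuous. Qed.

Hypothesis cK : compact K.

Lemma compact_row_pairs : compact row_pairs.
Proof.
apply: compact_closedI; first exact: compact_setX.
apply: closed_equalizer; apply: continuous_fun_comp; exact: snd_continuous ||
  exact: fst_continuous.
Qed.

Lemma compact_row_rel : compact row_rel.
Proof.
apply: compact_image_continuous compact_row_pairs => z.
exact: cvg_pair (c1 z) (c2 z).
Qed.

Lemma compact_wide d : compact (wide d).
Proof.
apply: compact_image_continuous => //.
apply: compact_closedI; first exact: compact_row_pairs.
exact/closed_superlevel/continuous_dist.
Qed.

Lemma compact_row_saturation Q : closed Q -> compact (row_saturation Q).
Proof.
move=> clQ; apply: compact_image_continuous.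
  by apply: continuous_fun_comp fst_continuous; exact: fst_continuous.
apply: compact_closedI.
  apply: compact_setX => //; apply: compact_closedI => //.
  exact: compact_row_pairs.
apply: closed_equalizer.
  by apply: continuous_fun_comp fst_continuous; exact: snd_continuous.
apply: continuous_fun_comp; first exact: snd_continuous.
by apply: continuous_fun_comp snd_continuous; exact: fst_continuous.
Qed.

Lemma row_rel_sym x y : row_rel (x, y) -> row_rel (y, x).
Proof.
by move=> [[p q] [[/= Kp Kq] pq] [<- <-]]; exists (q, p).
Qed.

Hypothesis KA : no_array3 K.

(** Otherwise [r], [p], [q] is an array with its corner at [p]. *)
Lemma column_uniq p q r : K p -> K q -> K r ->
  p.2 = q.2 -> p.1 <> q.1 -> r.1 = p.1 -> r = p.
Proof.
move=> Kp Kq Kr pq2 pq1 rp; apply: contrapT => nrp; apply: KA.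
exists r, p, q; do 3![split => //]; split => //; split; last by left.
by move=> pq; apply: pq1; rewrite pq.
Qed.

(** If the related points have distinct abscissae, the first is alone in its column, so the pair in
    [Q] lies in their common row. *)
Lemma row_saturationP Q x y :
  row_rel (x, y) -> row_saturation Q x -> row_saturation Q y.
Proof.
move=> [[a b] [[/= Ka Kb] ab] [<- <-]] [[r z] [[/= Kr Qz] rz] ra].
have [e|ne] := pselect (a.1 = b.1).
  by exists (r, z) => //=; rewrite ra.
have ra' : r = a := column_uniq _ _ _ Ka Kb Kr ab ne ra.
by exists (b, z) => //; split => //=; rewrite -ab -ra'.
Qed.

Lemma wide_column d p q : 0 < d -> K p -> K q ->
  wide d p.1 -> q.1 = p.1 -> q = p.
Proof.
move=> d0 Kp Kq [[a b] [[[/= Ka Kb] ab] dab] ap] qp.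
have ne : a.1 <> b.1 by move=> e; move: dab; rewrite e subrr normr0; lra.
rewrite (column_uniq _ _ _ Ka Kb Kq ab ne); last by rewrite ap.
by rewrite (column_uniq _ _ _ Ka Kb Kp ab ne).
Qed.

(** By the triangle inequality, [q] is at least [d / 2] away from one of two points of its row that
    are [d] apart. *)
Lemma wide_row d r q : 0 < d -> K r -> K q -> r.2 = q.2 ->
  wide d r.1 -> wide (d / 2) q.1.
Proof.
move=> d0 Kr Kq rq wr; have := wr => -[[a b] [[[/= Ka Kb] ab] dab] ar].
have {ar} ar : a = r by apply: (wide_column d).
have [qa|qa] := leP (d / 2) `|q.1 - a.1|.
  by exists (q, a) => //=; split=> //; split=> //=; rewrite ar.
exists (q, b) => //=; split; first by split=> //=; rewrite -rq -ar.
have := ler_distD q.1 a.1 b.1; rewrite (distrC a.1 q.1); lra.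
Qed.

End rows.

(** * Construction of [g] *)

Lemma row_potential {R : realType} (K : set (R * R)) (f : R * R -> R) (M e : R) :
  compact K -> no_array3 K -> continuous f -> 0 <= M -> 0 < e ->
  (forall p, K p -> `|f p| <= M) ->
  exists g : R -> R, [/\ continuous g, forall t, `|g t| <= M &
    forall p q, K p -> K q -> p.2 = q.2 ->
      `|(f p - g p.1) - (f q - g q.1)| <= 6 * e].
Proof.
move=> cK KA cf M0 e0 fM.
have cf1 : continuous (fun z : (R * R) * (R * R) => f z.1).
  exact: continuous_fun_comp fst_continuous.
have cf2 : continuous (fun z : (R * R) * (R * R) => f z.2).
  exact: continuous_fun_comp snd_continuous.
have c1 : continuous (fun z : (R * R) * (R * R) => z.1.1).
  by apply: continuous_fun_comp fst_continuous; exact: fst_continuous.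
have c2 : continuous (fun z : (R * R) * (R * R) => z.2.1).
  by apply: continuous_fun_comp snd_continuous; exact: fst_continuous.
have [||z|d d0 fd] := compact_pos_lb
    (row_pairs K `&` [set z | e <= `|f z.1 - f z.2|])
    (fun z => `|z.1.1 - z.2.1|).
- apply: compact_closedI; first exact: compact_row_pairs.
  exact/closed_superlevel/continuous_dist.
- exact: continuous_dist.
- case: z => -[x y] [x' y'] [[_ /= <-]] ef.
  rewrite normr_gt0 subr_eq0; apply/eqP => xx'.
  by move: ef; rewrite xx' subrr normr0; lra.
have d20 : 0 < d / 2 by lra.
have clw a : closed (wide K a).
  by apply: compact_closed; [exact: Rhausdorff|exact: compact_wide].
(* Over [wide K (d / 2)] each column is a single point, so [c = 0] is allowed. Using [d / 2] covers
   every point of a row that meets [wide K d]. *)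
have [||p q|g0 [cg0 g0M fg0]] := @approx_factor _ _
    (K `&` (fst @^-1` wide K (d / 2))) fst f M 0 e _ fst_continuous cf M0 e0.
- apply: compact_closedI => //; apply: closed_comp (clw _) => x _.
  exact: fst_continuous.
- by move=> p [/fM].
- move=> [Kp wp] [Kq wq] pq; rewrite (wide_column K KA _ _ _ d20 Kq Kp wq pq).
  by rewrite subrr normr0.
(* On rows through [wide K d], [f - g0] is within [e] of 0 and oscillates by at most [2 * e]; the
   threshold [3 * e] keeps [B] away from them. *)
pose Q : set ((R * R) * (R * R)) :=
  [set z | 3 * e <= `|(f z.1 - g0 z.1.1) - (f z.2 - g0 z.2.1)|].
have clQ : closed Q.
  apply/closed_superlevel/continuous_dist; apply: continuous_funB => //.
    exact: continuous_fun_comp c1.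
  exact: continuous_fun_comp c2.
pose B := row_saturation K Q.
have clB : closed B.
  apply: compact_closed; first exact: Rhausdorff.
  exact: compact_row_saturation.
have wB0 : wide K d `&` B = set0.
  apply/seteqP; split => // x [wr [[r [p q]]]].
  move=> [[/= Kr [[[/= Kp Kq] pq] Qpq]] rp] rx; rewrite -rx in wr.
  have wp := wide_row K KA _ _ _ d0 Kr Kp rp wr.
  have wq := wide_row K KA _ _ _ d0 Kr Kq (etrans rp pq) wr.
  have := fg0 p (conj Kp wp); have := fg0 q (conj Kq wq).
  by move: Qpq; rewrite /Q /= !ler_norml ler_normr; lra.
have Bsat := row_saturationP K KA Q.
(* Enough steps to make [M / n <= e]: a step of the cutoff times [g0] then costs at most [e]. *)
pose n := (Num.truncn (M / e)).+1.
have n0 : 0 < n%:R :> R by rewrite ltr0n.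
have Mn : M <= e * n%:R.
  by rewrite mulrC -ler_pdivrMr// ltW// truncnS_gt.
have [w [cw w0n wA wB wT]] := staircase (row_rel K) B (compact_row_rel K cK)
  (row_rel_sym K) clB Bsat n (wide K d) (clw d) wB0.
pose chi x := w x / n%:R.
have chi01 x : 0 <= chi x <= 1.
  by rewrite divr_ge0 ?ler0n ?ler_pdivrMr ?mul1r//; case/andP: (w0n x).
exists (fun x => chi x * g0 x); split.
- move=> x; apply: cvgM (cg0 x); apply: cvgM (cw x) _; exact: cvg_cst.
- move=> x; rewrite normrM (le_trans _ (g0M x))// ler_piMl//.
  by case/andP: (chi01 x) => h1 h2; rewrite ger0_norm.
move=> p q Kp Kq pq.
have Rpq : row_pairs K (p, q) by [].
have Rqp : row_pairs K (q, p) by [].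
have [dpq|dpq] := leP d `|p.1 - q.1|.
  have wp : wide K d p.1 by exists (p, q).
  have wq : wide K d q.1 by exists (q, p) => //; split=> //=; rewrite distrC.
  rewrite /chi !wA// divff ?gt_eqF// !mul1r.
  have := fg0 p (conj Kp (wide_row K KA _ _ _ d0 Kp Kp erefl wp)).
  have := fg0 q (conj Kq (wide_row K KA _ _ _ d0 Kq Kq erefl wq)).
  by rewrite !ler_norml; lra.
have fpq : `|f p - f q| < e.
  rewrite ltNge; apply/negP => efpq.
  have := fd (p, q) (conj Rpq efpq); rewrite /=; lra.
have dchi : `|(chi p.1 - chi q.1) * g0 p.1| <= e.
  rewrite /chi -mulrBl !normrM normfV (ger0_norm (ltW n0)) mulrAC.
  rewrite ler_pdivrMr// (le_trans _ Mn)// (le_trans _ (g0M p.1))//.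
  by rewrite ler_piMl//; apply: wT; exists (p, q).
have dg0 : `|chi q.1 * (g0 p.1 - g0 q.1)| <= 4 * e.
  have [Bq|nBq] := pselect (B q.1).
    by rewrite /chi wB// !mul0r normr0; lra.
  have nQ : `|(f p - g0 p.1) - (f q - g0 q.1)| < 3 * e.
    rewrite ltNge; apply/negP => Qpq; apply: nBq.
    by exists (q, (p, q)).
  have dg : `|g0 p.1 - g0 q.1| <= 4 * e.
    by move: nQ fpq; rewrite !ltr_norml ler_norml; lra.
  rewrite normrM (le_trans _ dg)// ler_piMl//.
  by case/andP: (chi01 q.1) => h1 h2; rewrite ger0_norm.
(* The three terms are bounded by [e], [e] and [4 * e]. *)
have -> : f p - chi p.1 * g0 p.1 - (f q - chi q.1 * g0 q.1) =
    (f p - f q) - (chi p.1 - chi q.1) * g0 p.1 - chi q.1 * (g0 p.1 - g0 q.1).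
  by lra.
by move: fpq dchi dg0; rewrite ltr_norml !ler_norml; lra.
Qed.

(** * Extension of [f] and choice of [g] and [h] *)

Theorem mainTheorem6 (R : realType) (K : set (R * R)) (f : R * R -> R) (eps : R) :
  compact K -> no_array3 K -> {within K, continuous f} -> 0 < eps ->
  exists g h : R -> R,
    continuous g /\ continuous h /\
    (forall p, K p -> `|f p - g p.1 - h p.2| <= 6 * eps) /\
    (forall t, `|g t| <= supnorm K f) /\
    (forall t, `|h t| <= 2 * supnorm K f).
Proof.
move=> cK KA cf e0.
have [M1 fM1] : has_ubound [set `|f p| | p in K].
  have /compact_bounded[M [_ bM]] := continuous_compact cf cK.
  exists (M + 1) => _ [p Kp <-].
  by apply: (bM (M + 1)); [rewrite ltrDl|exists p].
have fM p : K p -> `|f p| <= supnorm K f.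
  by move=> Kp; apply: ub_le_sup; [exists M1|exists p].
set M := supnorm K f in fM *.
have M0 : 0 <= M.
  have [[p Kp]|K0] := pselect (K !=set0); first exact: le_trans (fM p Kp).
  rewrite /M /supnorm [X in sup X](_ : _ = set0) ?sup0//.
  by apply/seteqP; split => // x [p Kp _]; case: K0; exists p.
have clK : closed K by apply: compact_closed => //; exact: norm_hausdorff.
(* Tietze extension asks for a positive bound and [M] may be 0, hence [M + 1]; later estimates use
   [f'] on [K] only, where [M] bounds it. *)
have [||f' [ff' cf' _]] := @continuous_bounded_extension _ R
  (@pseudometric_normal R (R * R)%type) K clK f (M + 1) _ cf; first lra.
  by move=> p /fM; lra.
have {}ff' p : K p -> f p = f' p by move=> Kp; apply: ff'; rewrite inE.
have f'M p : K p -> `|f' p| <= M by move=> Kp; rewrite -ff'//; exact: fM.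
(* With [eps / 2] in both steps the total error is [7 * (eps / 2)], below [6 * eps]. *)
have e20 : 0 < eps / 2 by lra.
have [g [cg gM gf]] := row_potential K f' M _ cK KA cf' M0 e20 f'M.
have [||p Kp||h [ch hM hf]] := approx_factor K snd (fun p => f' p - g p.1) (2 * M)
  (6 * (eps / 2)) (eps / 2) cK snd_continuous _ _ e20.
- by apply: continuous_funB => //; exact: continuous_fun_comp fst_continuous.
- lra.
- by have := f'M p Kp; have := gM p.1; rewrite !ler_norml; lra.
- exact: gf.
exists g, h; split=> //; split=> //; split=> [p Kp|]; last by split.
by rewrite ff'// (le_trans (hf p Kp))//; lra.
Qed.
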